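(* Let $(X,\|\cdot\|_X)$ be a superreflexive Banach space. Then there exist $c,C>0$ such that for every $f:\mathbb{H}\to X$ which is $1$-Lipschitz with respect to the metric $d_W$, there are $x,y\in \mathbb{H}$ with $d_W(x,y)$ arbitrarily large and $$\frac{\|f(x)-f(y)\|_X}{d_W(x,y)}\le \frac{C}{\left(\log d_W(x,y)\right)^c}.$$
   Context: $\mathbb{H}=\langle a,b \mid aba^{-1}b^{-1}\text{ is central}\rangle$ is the discrete Heisenberg group, and $d_W$ is the left-invariant word metric on $\mathbb{H}$ associated to the symmetric generating set $S=\{a,b,a^{-1},b^{-1}\}$. A Banach space $(X,\|\cdot\|_X)$ is superreflexive if it admits an equivalent uniformly convex norm, i.e. a norm $\|\cdot\|$ satisfying $\alpha\|x\|_X\le\|x\|\le\beta\|x\|_X$ for some $\alpha,\beta>0$ and all $x\in X$, such that for all $\varepsilon\in(0,1)$ there exists $\delta>0$ such that $\|x\|=\|y\|=1$ and $\|x-y\|=\varepsilon$ imply $\|x+y\|\le 2-\delta$. ''With $d_W(x,y)$ arbitrarily large'' means: for every $N$ there are such $x,y$ with $d_W(x,y)\ge N$. *)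

(* Defs.v *)
From HB Require Import structures.
From mathcomp Require Import all_boot all_order all_algebra.
From mathcomp Require Import all_classical all_reals all_analysis.
Import Order.TTheory GRing.Theory Num.Theory.
Import numFieldNormedType.Exports.
Set Implicit Arguments.
Unset Strict Implicit.
Unset Printing Implicit Defensive.

(* The discrete Heisenberg group < a, b | a b a^-1 b^-1 is central >, as the
   quotient of the words in a, b, a^-1, b^-1 by the least congruence that
   contains the cancellations and the centrality relations.
   A letter is a pair (g, e), where g selects the generator (false for a, true
   for b) and e tells whether it is inverted. *)
Definition letter := (bool * bool)%type.
Definition word := seq letter.

Definition letter_inv (l : letter) : letter := (l.1, ~~ l.2).
Definition word_inv (w : word) : word := rev (map letter_inv w).

Definition letter_a : letter := (false, false).
Definition letter_b : letter := (true, false).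

Definition commutator_word : word :=
  [:: letter_a; letter_b; letter_inv letter_a; letter_inv letter_b].

Inductive heis_eqv : word -> word -> Prop :=
| heis_refl u : heis_eqv u u
| heis_sym u v : heis_eqv u v -> heis_eqv v u
| heis_trans v u w : heis_eqv u v -> heis_eqv v w -> heis_eqv u w
| heis_cat u1 u2 v1 v2 :
    heis_eqv u1 v1 -> heis_eqv u2 v2 -> heis_eqv (u1 ++ u2) (v1 ++ v2)
| heis_cancel l : heis_eqv [:: l; letter_inv l] [::]
| heis_central w :
    heis_eqv (commutator_word ++ w) (w ++ commutator_word).

Definition heis_eqvb (u v : word) : bool := `[< heis_eqv u v >].

Lemma heis_eqvb_refl : reflexive heis_eqvb.
Proof. by move=> u; apply/asboolP; exact: heis_refl. Qed.

Lemma heis_eqvb_sym : symmetric heis_eqvb.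
Proof. by move=> u v; apply/asboolP/asboolP; exact: heis_sym. Qed.

Lemma heis_eqvb_trans : transitive heis_eqvb.
Proof.
by move=> v u w /asboolP uv /asboolP vw; apply/asboolP; exact: heis_trans vw.
Qed.

Canonical heis_equiv_rel :=
  EquivRel heis_eqvb heis_eqvb_refl heis_eqvb_sym heis_eqvb_trans.

Local Open Scope quotient_scope.

Definition heis := {eq_quot heis_equiv_rel}.

HB.instance Definition _ := EqQuotient.on heis.
HB.instance Definition _ := Choice.on heis.

Definition heis_of (w : word) : heis := \pi_heis w.
Definition heis_mul (x y : heis) : heis := heis_of (repr x ++ repr y).
Definition heis_inv (x : heis) : heis := heis_of (word_inv (repr x)).

Lemma heis_ofP u v : heis_of u = heis_of v <-> heis_eqv u v.
Proof.
by split=> [/eqmodP/asboolP|uv]; [|apply/eqmodP/asboolP].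
Qed.

Lemma heis_ofK x : heis_of (repr x) = x.
Proof. exact: reprK. Qed.

Lemma heis_of_cat u v : heis_of (u ++ v) = heis_mul (heis_of u) (heis_of v).
Proof.
by apply/heis_ofP/heis_cat; apply/heis_ofP; rewrite heis_ofK.
Qed.

Lemma letter_invK : involutive letter_inv.
Proof. by case=> g e; rewrite /letter_inv /= negbK. Qed.

Lemma word_invK : involutive word_inv.
Proof.
by move=> w; rewrite /word_inv map_rev revK -map_comp map_id_in // => l _;
   exact: letter_invK.
Qed.

Lemma heis_wordV w : heis_eqv (w ++ word_inv w) [::].
Proof.
elim: w => [|l w IHw]; first exact: heis_refl.
have ->: (l :: w) ++ word_inv (l :: w) =
         [:: l] ++ ((w ++ word_inv w) ++ [:: letter_inv l]).
  by rewrite /word_inv /= rev_cons -cats1 !catA.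
apply: heis_trans (heis_cancel l).
apply: (@heis_cat [:: l] _ [:: l] [:: letter_inv l]); first exact: heis_refl.
exact: (heis_cat IHw (heis_refl [:: letter_inv l])).
Qed.

Lemma heis_mulA : associative heis_mul.
Proof.
move=> x y z; rewrite -[x]heis_ofK -[y]heis_ofK -[z]heis_ofK.
by rewrite -!heis_of_cat catA.
Qed.

Lemma heis_mul1 : left_id (heis_of [::]) heis_mul.
Proof. by move=> x; rewrite -[x]heis_ofK -heis_of_cat. Qed.

Lemma heis_mulx1 : right_id (heis_of [::]) heis_mul.
Proof. by move=> x; rewrite -[x]heis_ofK -heis_of_cat cats0. Qed.

Lemma heis_mulxV : right_inverse (heis_of [::]) heis_inv heis_mul.
Proof.
by move=> x; rewrite -{1}[x]heis_ofK -heis_of_cat; exact/heis_ofP/heis_wordV.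
Qed.

Lemma heis_mulVx : left_inverse (heis_of [::]) heis_inv heis_mul.
Proof.
move=> x; rewrite -{2}[x]heis_ofK -heis_of_cat; apply/heis_ofP.
by rewrite -{2}[repr x]word_invK; exact: heis_wordV.
Qed.

HB.instance Definition _ :=
  isGroup.Build heis heis_mulA heis_mul1 heis_mulx1 heis_mulVx heis_mulxV.

Local Open Scope group_scope.

Definition heis_a : heis := heis_of [:: letter_a].
Definition heis_b : heis := heis_of [:: letter_b].

Definition heis_S : seq heis := [:: heis_a; heis_b; heis_a^-1; heis_b^-1].

Definition is_product_of_length (G : groupType) (S : seq G) (x : G) (n : nat) :=
  exists s : seq G, [/\ size s = n, {subset s <= S} & \big[*%g/1]_(g <- s) g = x].

Lemma heis_S_generates (x : heis) :
  exists n, `[< is_product_of_length heis_S x n >].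
Proof.
have heis_letter l : heis_of [:: l] \in heis_S.
  have invE g : heis_of [:: (g, true)] = (heis_of [:: (g, false)])^-1.
    apply: (mulgI (heis_of [:: (g, false)])); rewrite mulgV.
    by rewrite -[LHS]heis_of_cat; exact/heis_ofP/(heis_cancel (g, false)).
  by case: l => [[] []]; rewrite ?invE !inE eqxx ?orbT.
exists (size (repr x)); apply/asboolP.
exists [seq heis_of [:: l] | l <- repr x]; split; first by rewrite size_map.
  by move=> g /mapP[l _ ->].
rewrite big_map -[RHS]heis_ofK; elim: (repr x) => [|l w IHw].
  by rewrite big_nil.
by rewrite big_cons IHw -[LHS]heis_of_cat.
Qed.

Definition word_length (x : heis) : nat := ex_minn (heis_S_generates x).

Definition d_W (x y : heis) : nat := word_length (x^-1 * y).

Local Close Scope group_scope.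
Local Open Scope ring_scope.

Definition is_norm (R : realType) (X : lmodType R) (N : X -> R) : Prop :=
  [/\ forall x, N x = 0 -> x = 0,
      forall (a : R) x, N (a *: x) = `|a| * N x &
      forall x y, N (x + y) <= N x + N y].

Definition equivalent_norm (R : realType) (X : normedModType R) (N : X -> R) :
    Prop :=
  is_norm N /\
  exists alpha beta : R, [/\ 0 < alpha, 0 < beta &
    forall x : X, alpha * `|x| <= N x <= beta * `|x|].

Definition uniformly_convex (R : realType) (X : lmodType R) (N : X -> R) :
    Prop :=
  forall eps : R, 0 < eps < 1 ->
  exists2 delta : R, 0 < delta &
    forall x y : X, N x = 1 -> N y = 1 -> N (x - y) = eps ->
      N (x + y) <= 2 - delta.

Definition superreflexive (R : realType) (X : completeNormedModType R) : Prop :=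
  exists N : X -> R, equivalent_norm N /\ uniformly_convex N.

(* Main.v *)
Require Import Defs.
From HB Require Import structures.
From mathcomp Require Import all_boot all_order all_algebra.
From mathcomp Require Import all_classical all_reals all_analysis.
From mathcomp Require Import zify ring lra.
Import Order.TTheory GRing.Theory Num.Theory.
Import numFieldNormedType.Exports.
Local Open Scope ring_scope.

(** Let [c = a b a^-1 b^-1]. The points [x] and [y = x c^(n^2)] are at distance
between [n] and [4 n], and they are found with [f x] and [f y] much closer to
each other than [n].

If [f] were affine along the [a]-lines and [b]-lines near [z], up to a scale
[K n] much larger than [n], this would be clear. The [a]-lines through [z] and
[z b^n] separate by only about [sqrt K * n] over a length [K n], because a
central element [c^m] has length of order [sqrt m]; hence the slopes of [f] on
the two lines differ by at most the order of [1 / sqrt K], and the increments of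
[f] along [a^n] at [z] and at [z b^n] almost coincide. The same is true with [a] and [b]
exchanged, and going around the square shows that [f (z a^n b^n)] and
[f (z b^n a^n)] almost coincide ([parallel_increments], [center_collapse]). The
two points differ by [c^(n^2)].

A Lipschitz map into a uniformly convex space is almost affine along most lines
at most scales. The slopes of [f] over the [K]-adic intervals of a line form a
bounded martingale. Uniform convexity makes two consecutive increments of size
[mu] add up to an increment of size at least [(1 + k) mu], for squares of
[L^2] norms ([slope_gap_growth]). Doubling [p] times, if all the [2^p] increments
between consecutive scales were larger than [mu], the total increment would be
larger than [(1 + k)^p mu]; so one of them is of order [(1 + k)^-p]
([coarse_differentiation]). Uniform convexity at a single scale
([uniformly_convex_sqr]) thus yields a power of the number of scales.
The martingales of all [a]-lines and [b]-lines through a large box are treated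
as a single one, so that one scale is good for both directions, and a corner [z]
whose four lines are all good exists by averaging ([box_choice]).

With [K = 4^p] and [2^p] scales, [log n] is at most of order [4^p], whereas the
error relative to [n] is [rho^p] with [rho = (1 + k)^(-1/2)]. So the error is
bounded by a negative power of [log n]. *)

(** * Uniform convexity at one scale *)

Section Norms.
Variables (R : realType) (V : lmodType R) (N : V -> R).
Hypothesis normN : is_norm N.

Lemma is_normZ (r : R) v : N (r *: v) = `|r| * N v.
Proof. by case: normN => _ + _; apply. Qed.

Lemma is_norm_ler_add u v : N (u + v) <= N u + N v.
Proof. by case: normN => _ _; apply. Qed.

Lemma is_norm0 : N 0 = 0.
Proof. by rewrite -(scale0r (0 : V)) is_normZ normr0 mul0r. Qed.

Lemma is_normN v : N (- v) = N v.
Proof. by rewrite -scaleN1r is_normZ normrN1 mul1r. Qed.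

Lemma is_norm_ge0 v : 0 <= N v.
Proof.
have := is_norm_ler_add v (- v); rewrite subrr is_norm0 is_normN; lra.
Qed.

Lemma is_norm_distC u v : N (u - v) = N (v - u).
Proof. by rewrite -is_normN opprB. Qed.

Lemma is_norm_ler_sub u v : N (u - v) <= N u + N v.
Proof. by rewrite -(is_normN v); exact: is_norm_ler_add. Qed.

Lemma is_norm_dist u v : N u - N v <= N (u - v).
Proof. by rewrite lerBlDr; have := is_norm_ler_add (u - v) v; rewrite subrK. Qed.

Lemma is_norm_sum (I : Type) (r : seq I) (F : I -> V) :
  N (\sum_(i <- r) F i) <= \sum_(i <- r) N (F i).
Proof.
elim: r => [|i r IHr]; first by rewrite !big_nil is_norm0.
by rewrite !big_cons (le_trans (is_norm_ler_add _ _))// lerD2l.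
Qed.

Lemma lipschitz_continuous (g : R -> R) (k : R) :
  (forall s t, `|g s - g t| <= k * `|s - t|) -> continuous g.
Proof.
move=> gk t; apply/cvgrPdist_lt => e e0.
have k1 : 0 < `|k| + 1 by rewrite ltr_wpDl.
near=> s; apply: (le_lt_trans (gk _ _)).
have st : `|t - s| < e / (`|k| + 1).
  by near: s; apply: cvgr_dist_lt; [exact: cvg_id|rewrite divr_gt0].
apply: (@le_lt_trans _ _ ((`|k| + 1) * `|t - s|)).
  by rewrite ler_wpM2r// (le_trans (ler_norm _))// lerDl.
by rewrite mulrC -ltr_pdivlMr.
Unshelve. all: by end_near. Qed.

(** The hypothesis controls [N (x + y)] only when [N (x - y)] is exactly [eps].
For unit vectors further apart, moving along the segment from [x] towards [y]
gives, by the intermediate value theorem, a point whose radial projection [u]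
satisfies [N (x - u) = eps]. If [N (x + y)] is close to 2 then the norm is
close to 1 on the whole segment, so [N (x + u)] is close to 2 as well. *)
Lemma uniformly_convex_monotone (eps : R) : 0 < eps < 1 -> uniformly_convex N ->
  exists2 delta : R, 0 < delta <= 1 &
    forall x y, N x = 1 -> N y = 1 -> eps <= N (x - y) -> N (x + y) <= 2 - delta.
Proof.
move=> eps01 /(_ _ eps01)[d0 d0_gt0 UC].
(* Three errors of size at most [d] add up below, so [3 * d < d0] is needed. *)
pose d := Num.min (d0 / 4) 2^-1.
have [d_gt0 dd0 d2] : [/\ 0 < d, d <= d0 / 4 & d <= 2^-1].
  rewrite /d; split; [|by rewrite ge_min lexx|by rewrite ge_min lexx orbT].
  by rewrite lt_min; apply/andP; split; lra.
exists d => [|x y Nx Ny xy]; first lra.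
rewrite leNgt; apply/negP => bad.
pose z t := x + t *: (y - x).
have zE t : z t = (1 - t) *: x + t *: y.
  by rewrite /z scalerBr scalerBl scale1r addrAC addrA.
have zle t : 0 <= t <= 1 -> N (z t) <= 1.
  move=> t01; rewrite zE; apply: (le_trans (is_norm_ler_add _ _)).
  rewrite !is_normZ Nx Ny !ger0_norm; lra.
have zge t : 0 <= t <= 1 -> 1 - d <= N (z t).
  move=> t01; have /zle : 0 <= 1 - t <= 1 by lra.
  have: N (x + y) <= N (z t) + N (z (1 - t)).
    apply: le_trans (is_norm_ler_add _ _); rewrite le_eqVlt; apply/orP; left.
    apply/eqP; congr N; rewrite /z addrACA -scalerDl (_ : t + _ = 1); last by ring.
    by rewrite scale1r addrAC addrA subrK addrC.
  lra.
have zB s t : z s - z t = (s - t) *: (y - x).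
  by rewrite /z opprD addrACA subrr add0r scalerBl.
have zlip s t : N (z s - z t) <= `|s - t| * 2.
  by rewrite zB is_normZ ler_wpM2l//; have := is_norm_ler_sub y x; lra.
have zdist s t : `|N (z s) - N (z t)| <= `|s - t| * 2.
  rewrite ler_norml; have := zlip s t; have := is_norm_dist (z s) (z t).
  have := is_norm_dist (z t) (z s); rewrite (is_norm_distC (z t)); lra.
(* A zero of [g] is a point of the segment whose projection is at distance
   [eps] from [x]; clearing the denominator keeps [g] Lipschitz. *)
pose g t := N (N (z t) *: x - z t) - eps * N (z t).
have g_lip s t : `|g s - g t| <= 6 * `|s - t|.
  have : `|N (N (z s) *: x - z s) - N (N (z t) *: x - z t)| <= 4 * `|s - t|.
    suff le4 : N ((N (z s) *: x - z s) - (N (z t) *: x - z t)) <= 4 * `|s - t|.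
      rewrite ler_norml; have := le4; rewrite is_norm_distC => le4'.
      have := is_norm_dist (N (z t) *: x - z t) (N (z s) *: x - z s).
      have := is_norm_dist (N (z s) *: x - z s) (N (z t) *: x - z t); lra.
    have -> : N (z s) *: x - z s - (N (z t) *: x - z t) =
              (N (z s) - N (z t)) *: x - (z s - z t).
      by rewrite scalerBl !opprB addrACA [RHS]addrACA [- z s - _]addrC.
    apply: (le_trans (is_norm_ler_sub _ _)); rewrite is_normZ Nx.
    by have := zlip s t; have := zdist s t; lra.
  have : `|eps * N (z s) - eps * N (z t)| <= 2 * `|s - t|.
    rewrite -mulrBr normrM ger0_norm; last lra.
    apply: (le_trans _ (_ : `|N (z s) - N (z t)| <= _)); last by rewrite mulrC.
    by rewrite ler_piMl//; lra.
  rewrite /g !ler_norml; lra.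
have z0 : z 0 = x by rewrite /z scale0r addr0.
have z1 : z 1 = y by rewrite /z scale1r addrC subrK.
have [t + gt0] : exists2 t, t \in `[0, 1] & g t = 0.
  apply: IVT => //; first exact/continuous_subspaceT/lipschitz_continuous/g_lip.
  rewrite /g z0 z1 Nx Ny !scale1r subrr is_norm0.
  by rewrite ge_min le_max; apply/andP; split; apply/orP; lra.
rewrite in_itv/= => t01.
have zt := zge _ t01; have phi_gt0 : 0 < N (z t) by lra.
pose u := (N (z t))^-1 *: z t.
have phiu : N (z t) *: u = z t by rewrite /u scalerA divff ?scale1r// gt_eqF.
have Nu : N u = 1.
  by apply: (mulfI (lt0r_neq0 phi_gt0)); rewrite mulr1 -{1}[N (z t)]ger0_norm ?(ltW phi_gt0)// -is_normZ phiu.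
have xu : N (x - u) = eps.
  apply: (mulfI (lt0r_neq0 phi_gt0)); rewrite -{1}[N (z t)]ger0_norm ?(ltW phi_gt0)// -is_normZ scalerBr phiu.
  by move: gt0; rewrite /g; lra.
have := UC _ _ Nx Nu xu.
have : 2 * N (z (t / 2)) <= N (x + z t).
  rewrite -{1}[2]ger0_norm// -is_normZ le_eqVlt; apply/orP; left; apply/eqP; congr N.
  by rewrite /z scalerDr scalerA mulrC divfK ?pnatr_eq0// scaler_nat mulr2n addrA.
have /zge : 0 <= t / 2 <= 1 by lra.
have : N (x + z t) <= N (x + u) + (1 - N (z t)).
  have -> : x + z t = x + u - (1 - N (z t)) *: u.
    by rewrite scalerBl phiu scale1r -addrA opprB [u + _]addrC subrK.
  apply: (le_trans (is_norm_ler_sub _ _)); rewrite is_normZ Nu mulr1 ger0_norm//.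
  by have := zle _ t01; lra.
lra.
Qed.

(** Uniform convexity at a single scale, in a form linear in the squares of the
norms and hence stable under summation: this is what replaces the uniform
convexity of the space of square-integrable functions with values in [V]. The
bracket is nonpositive, and convexity suffices, unless [x - y] is large
compared with [x] and [y]. In that case, with [N y <= N x = 1], either [N y] is
far below 1 and the strict convexity of the square gives the gain, or [y] is
close to a unit vector and uniform convexity does. *)
Lemma uniformly_convex_sqr : uniformly_convex N ->
  exists2 k : R, 0 < k <= 1 & forall x y,
    N (x + y) ^+ 2 + k * (8 * N (x - y) ^+ 2 - (N x ^+ 2 + N y ^+ 2)) <=
    2 * (N x ^+ 2 + N y ^+ 2).
Proof.
move=> UC; have eps01 : 0 < (20^-1 : R) < 1 by lra.
have [d d01 {}UC] := uniformly_convex_monotone _ eps01 UC.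
(* [1 / 512] is the gain [(1/4)^2] divided by the bound 32 of the bracket. *)
pose k := Num.min (d / 40) (512^-1).
have [k_gt0 kd k2] : [/\ 0 < k, k <= d / 40 & k <= 512^-1].
  rewrite /k; split; [|by rewrite ge_min lexx|by rewrite ge_min lexx orbT].
  by rewrite lt_min; apply/andP; split; lra.
exists k; first lra.
have unit_case x y : N x = 1 -> N y <= 1 ->
    N (x + y) ^+ 2 + k * (8 * N (x - y) ^+ 2 - (N x ^+ 2 + N y ^+ 2)) <=
    2 * (N x ^+ 2 + N y ^+ 2).
  move=> Nx Ny; rewrite Nx expr1n.
  have Ny0 := is_norm_ge0 y; have NxBy0 := is_norm_ge0 (x - y).
  have NxDy0 := is_norm_ge0 (x + y).
  have NxBy := is_norm_ler_sub x y; have NxDy := is_norm_ler_add x y.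
  rewrite Nx in NxBy NxDy.
  have [small|] := leP (8 * N (x - y) ^+ 2) (1 + N y ^+ 2).
    have : N (x + y) ^+ 2 <= (1 + N y) ^+ 2 by rewrite lerXn2r// ?nnegrE; lra.
    have : k * (8 * N (x - y) ^+ 2 - (1 + N y ^+ 2)) <= 0 by rewrite mulr_ge0_le0; lra.
    have := sqr_ge0 (1 - N y); lra.
  move=> far; have {far} far : 3 / 10 <= N (x - y).
    rewrite leNgt; apply/negP => near.
    have : N (x - y) ^+ 2 <= (3/10) ^+ 2 by rewrite lerXn2r// ?nnegrE; lra.
    have := sqr_ge0 (N y); lra.
  have : k * (8 * N (x - y) ^+ 2 - (1 + N y ^+ 2)) <= k * 32.
    rewrite ler_wpM2l//; first lra.
    have : N (x - y) ^+ 2 <= 2 ^+ 2 by rewrite lerXn2r// ?nnegrE; lra.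
    have := sqr_ge0 (N y); lra.
  have [y_small|y_large] := leP (N y) (3/4).
    have : N (x + y) ^+ 2 <= (1 + N y) ^+ 2 by rewrite lerXn2r// ?nnegrE; lra.
    have : 4^-1 ^+ 2 <= (1 - N y) ^+ 2 by rewrite lerXn2r// ?nnegrE; lra.
    lra.
  pose u := (N y)^-1 *: y; have Ny_gt0 : 0 < N y by lra.
  have yE : y = N y *: u by rewrite /u scalerA divff ?scale1r// gt_eqF.
  have Nu : N u = 1 by rewrite /u is_normZ ger0_norm ?mulVf ?gt_eqF// invr_ge0.
  have : N (x - y) <= N (x - u) + (1 - N y).
    have -> : x - y = x - u + (1 - N y) *: u.
      by rewrite scalerBl scale1r -yE addrA subrK.
    apply: (le_trans (is_norm_ler_add _ _)).
    by rewrite is_normZ Nu mulr1 ger0_norm//; lra.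
  move=> xu; have {xu} /(UC _ _ Nx Nu) xu : 20^-1 <= N (x - u) by lra.
  have : N (x + y) <= 1 + N y - N y * d.
    have -> : x + y = N y *: (x + u) + (1 - N y) *: x.
      by rewrite scalerDr -yE scalerBl scale1r addrAC [_ *: x + _]addrC subrK.
    apply: (le_trans (is_norm_ler_add _ _)); rewrite !is_normZ Nx.
    rewrite !ger0_norm//; last lra.
    have : N y * N (x + u) <= N y * (2 - d) by rewrite ler_wpM2l.
    lra.
  move=> xy.
  have : N (x + y) ^+ 2 <= (1 + N y - N y * d) * (1 + N y).
    by rewrite expr2 ler_pM//; nra.
  have : N y * d >= 3/4 * d by rewrite ler_wpM2r//; lra.
  have : 0 <= N y * (N y * d) by rewrite !mulr_ge0//; lra.
  have := sqr_ge0 (1 - N y); nra.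
have le_case x y : N y <= N x ->
    N (x + y) ^+ 2 + k * (8 * N (x - y) ^+ 2 - (N x ^+ 2 + N y ^+ 2)) <=
    2 * (N x ^+ 2 + N y ^+ 2).
  move=> yx; have [Nx0|Nx0] := eqVneq (N x) 0.
    have Ny0 := is_norm_ge0 y; have {}Ny0 : N y = 0 by lra.
    have NxBy0 := is_norm_ge0 (x - y); have NxDy0 := is_norm_ge0 (x + y).
    have := is_norm_ler_sub x y; have := is_norm_ler_add x y.
    move=> NxDy NxBy; have -> : N (x + y) = 0 by lra.
    have -> : N (x - y) = 0 by lra.
    by rewrite Nx0 Ny0 expr2; lra.
  have Nx_gt0 : 0 < N x by rewrite lt_neqAle eq_sym Nx0 is_norm_ge0.
  pose r := (N x)^-1; have r_ge0 : 0 <= r by rewrite invr_ge0 ltW.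
  have Nr v : N (r *: v) = r * N v by rewrite is_normZ ger0_norm.
  have rx : r * N x = 1 by rewrite mulVf.
  have ry : r * N y <= 1 by rewrite -rx ler_wpM2l.
  have := unit_case (r *: x) (r *: y); rewrite -scalerBr -scalerDr !Nr.
  move=> /(_ rx ry) scaled; have r2_gt0 : 0 < r ^+ 2 by rewrite exprn_gt0// invr_gt0.
  by rewrite -(ler_pM2l r2_gt0); move: scaled; lra.
move=> x y; have [yx|/ltW xy] := leP (N y) (N x); first exact: le_case.
move: (le_case _ _ xy).
by rewrite is_norm_distC [y + x]addrC [N y ^+ 2 + _]addrC.
Qed.

End Norms.

(** * Coarse differentiation *)

Lemma growth_arith {R : realFieldType} {k U W D Z mu : R} :
  0 < k <= 1 -> 0 <= mu -> U <= W -> 4 * U <= Z ->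
  Z + k * (8 * D - (U + W)) <= 2 * (U + W) -> mu < D -> mu < U ->
  (1 + k) * mu < W.
Proof.
move=> k01 mu0 UW U4 conv muD muU; rewrite ltNge; apply/negP => Wmu.
have kD : k * mu < k * D by rewrite ltr_pM2l//; lra.
have kUW : k * (U + W) <= k * (2 * ((1 + k) * mu)) by apply: ler_wpM2l; lra.
have kk : k * (k * mu) <= k * mu.
  by rewrite ler_wpM2l//; [lra|rewrite ler_piMl//; lra].
nra.
Qed.

Section Slopes.
Variables (R : realType) (V : lmodType R).
Implicit Types (h : nat -> V) (n M t : nat).

(** The average speed of [h] on the interval [[q * n, q.+1 * n]] that contains
[t]. For [n] running along a chain of divisors these are the terms of a
martingale: refining the intervals averages the slopes. *)
Definition slope h n t : V :=
  n%:R^-1 *: (h ((t %/ n).+1 * n)%N - h (t %/ n * n)%N).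

Lemma divn_block n q t : (q * n <= t < q.+1 * n)%N -> (t %/ n = q)%N.
Proof.
move=> /andP[qt tq]; have n_gt0 : (0 < n)%N by case: n qt tq => //; rewrite !muln0.
by apply/eqP; rewrite eqn_leq -ltnS ltn_divLR// tq leq_divRL.
Qed.

Lemma sum_slope h n a b : (0 < n)%N -> (a <= b)%N ->
  \sum_(a * n <= t < b * n) slope h n t = h (b * n)%N - h (a * n)%N.
Proof.
move=> n_gt0 /subnKC <-; elim: (b - a)%N => [|s IHs].
  by rewrite addn0 big_geq// subrr.
rewrite addnS (@big_cat_nat _ _ _ ((a + s) * n)) ?leq_mul2r ?leq_addr ?leqnSn ?orbT//.
rewrite IHs /=.
rewrite [X in _ + X](_ : _ = h ((a + s).+1 * n)%N - h ((a + s) * n)%N).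
  by rewrite [LHS]addrC addrA subrK.
rewrite (eq_big_nat _ _ (F2 := fun=> n%:R^-1 *: (h ((a + s).+1 * n)%N - h ((a + s) * n)%N))).
  rewrite big_const_nat -mulnBl subSnn mul1n iter_addr addr0 -scaler_nat scalerA.
  by rewrite divff ?scale1r// pnatr_eq0 -lt0n.
by move=> t tn; rewrite /slope (divn_block n (a + s)).
Qed.

Variables (N : V -> R).
Hypothesis normN : is_norm N.

(** Jensen's inequality. Since [2 * N c * s - N c ^ 2 <= s ^ 2], it follows from
the triangle inequality for the sum. *)
Lemma sqr_norm_average (a n : nat) (w : nat -> V) (c : V) :
  \sum_(a <= t < a + n) w t = n%:R *: c ->
  n%:R * N c ^+ 2 <= \sum_(a <= t < a + n) N (w t) ^+ 2.
Proof.
move=> wc.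
have le1 : \sum_(a <= t < a + n) (2 * N c * N (w t) - N c ^+ 2) <=
    \sum_(a <= t < a + n) N (w t) ^+ 2.
  by apply: ler_sum => t _; have := sqr_ge0 (N (w t) - N c); lra.
apply: le_trans le1.
rewrite sumrB -mulr_sumr big_const_nat iter_addr addr0 addKn -mulr_natl.
suff : n%:R * N c <= \sum_(a <= t < a + n) N (w t).
  move=> H; have := ler_wpM2l (is_norm_ge0 _ _ _ normN c) H; lra.
rewrite -[X in X * _ <= _](ger0_norm (ler0n R n)) -(is_normZ _ _ _ normN) -wc.
exact: is_norm_sum.
Qed.

(** The conditional expectation contracts: [slope h M] is the average of
[slope h n] over the blocks of length [M], and [A] is constant on them. *)
Lemma le_sum_slope h n M T (A : nat -> V) :
  (0 < M)%N -> (n %| M)%N -> (M %| T)%N ->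
  (forall t, A t = A (t %/ M * M)%N) ->
  \sum_(0 <= t < T) N (slope h M t + A t) ^+ 2 <=
  \sum_(0 <= t < T) N (slope h n t + A t) ^+ 2.
Proof.
move=> M_gt0 nM /dvdnP[s ->] A_const; have n_gt0 := dvdn_gt0 M_gt0 nM.
rewrite !big_nat_mul; apply: ler_sum => q _.
pose c := slope h M (q * M) + A (q * M)%N.
rewrite (eq_big_nat _ _ (F2 := fun=> N c ^+ 2)); last first.
  by move=> t tq; rewrite /c A_const (divn_block M q)// /slope (divn_block M q)// mulnK.
rewrite big_const_nat iter_addr addr0 -mulnBl subSnn mul1n -mulr_natl mulSn [(M + _)%N]addnC.
apply: sqr_norm_average; rewrite big_split/= [X in _ + X](eq_big_nat _ _ (F2 := fun=> A (q * M)%N)).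
  rewrite big_const_nat addKn iter_addr addr0 -scaler_nat scalerDr; congr (_ + _).
  rewrite /slope mulnK// scalerA divff ?scale1r ?pnatr_eq0 -?lt0n//.
  case/dvdnP: nM => r Mr; rewrite -[X in \sum_(_ <= _ < X) _]mulSnr Mr !mulnA.
  by rewrite sum_slope// leq_mul2r leqnSn orbT.
by move=> t tq; rewrite A_const (divn_block M q)// mulSnr.
Qed.

Lemma slope_bound h B n t : (0 < n)%N ->
  (forall t, N (h t.+1 - h t) <= B) -> N (slope h n t) <= B.
Proof.
move=> n_gt0 hB; rewrite /slope (is_normZ _ _ _ normN) ger0_norm ?invr_ge0//.
rewrite ler_pdivrMl ?ltr0n// mulSn addnC.
elim: n {n_gt0} (_ * _)%N => [|n IHn] m.
  by rewrite addn0 subrr (is_norm0 _ _ _ normN) mul0r.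
have -> : h (m + n.+1)%N - h m = (h (m + n).+1 - h (m + n)%N) + (h (m + n)%N - h m).
  by rewrite addrA subrK addnS.
apply: (le_trans (is_norm_ler_add _ _ _ normN _ _)).
by rewrite -natr1 mulrDl mul1r addrC lerD.
Qed.

Section Family.
Variables (k : R) (k01 : 0 < k <= 1).
Hypothesis convN : forall x y,
    N (x + y) ^+ 2 + k * (8 * N (x - y) ^+ 2 - (N x ^+ 2 + N y ^+ 2)) <=
    2 * (N x ^+ 2 + N y ^+ 2).
Variables (I : finType) (h : I -> nat -> V).

Definition slope_gap (T n M : nat) : R :=
  \sum_(i : I) \sum_(0 <= t < T) N (slope (h i) n t - slope (h i) M t) ^+ 2.

(** Two consecutive martingale increments of size at least [mu] add up to an
increment larger by a definite factor. Write [u] for the increment from [M'] to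
[M] and [v] for the one from [M] to [n]. Conditional expectation shows that
[2 u + v] is at least as large as [2 u], and [2 u + v] is the sum of [u] and
[u + v], whose difference [v] is not small; so uniform convexity forces [u + v]
to be larger than [u]. *)
Lemma slope_gap_growth T n M M' (mu : R) : 0 <= mu ->
  (0 < M')%N -> (n %| M)%N -> (M %| M')%N -> (M' %| T)%N ->
  mu < slope_gap T n M -> mu < slope_gap T M M' ->
  (1 + k) * mu < slope_gap T n M'.
Proof.
move=> mu0 M'_gt0 nM MM' M'T; have M_gt0 := dvdn_gt0 M'_gt0 MM'.
have MT := dvdn_trans MM' M'T.
have slope_blocks i t : slope (h i) M' t = slope (h i) M' (t %/ M * M).
  rewrite /slope; suff -> : ((t %/ M * M) %/ M' = t %/ M')%N by [].
  by case/dvdnP: MM' => r ->; rewrite [(r * M)%N]mulnC !divnMA mulnK.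
set D := slope_gap T n M; set U := slope_gap T M M'; set W := slope_gap T n M'.
have UW : U <= W.
  apply: ler_sum => i _.
  apply: (le_sum_slope _ _ _ _ (fun t => - slope (h i) M' t)) => // t.
  by rewrite slope_blocks.
pose mid i t := (slope (h i) M t - slope (h i) M' t) + (slope (h i) n t - slope (h i) M' t).
have U4 : 4 * U <= \sum_(i : I) \sum_(0 <= t < T) N (mid i t) ^+ 2.
  rewrite /U /slope_gap mulr_sumr; apply: ler_sum => i _.
  pose A t := slope (h i) M t - slope (h i) M' t - slope (h i) M' t.
  have := le_sum_slope (h i) n M T A M_gt0 nM MT.
  have -> : \sum_(0 <= t < T) N (slope (h i) M t + A t) ^+ 2 =
      4 * \sum_(0 <= t < T) N (slope (h i) M t - slope (h i) M' t) ^+ 2.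
    rewrite mulr_sumr; apply: eq_bigr => t _.
    rewrite (_ : _ + A t = 2 *: (slope (h i) M t - slope (h i) M' t)).
      by rewrite (is_normZ _ _ _ normN) exprMn ger0_norm//; ring.
    by rewrite /A scaler_nat mulr2n addrCA.
  have -> : \sum_(0 <= t < T) N (slope (h i) n t + A t) ^+ 2 =
      \sum_(0 <= t < T) N (mid i t) ^+ 2.
    apply: eq_bigr => t _; congr (N _ ^+ 2).
    by rewrite /A /mid addrCA.
  by apply => t; rewrite /A -slope_blocks /slope mulnK.
have conv : (\sum_(i : I) \sum_(0 <= t < T) N (mid i t) ^+ 2) + k * (8 * D - (U + W)) <=
    2 * (U + W).
  rewrite /U /W /D /slope_gap -!big_split/= !mulr_sumr -sumrB mulr_sumr -big_split/=.
  apply: ler_sum => i _.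
  rewrite -!big_split/= !mulr_sumr -sumrB mulr_sumr -big_split/=.
  apply: ler_sum => t _; have := convN (slope (h i) M t - slope (h i) M' t)
    (slope (h i) n t - slope (h i) M' t).
  rewrite (_ : _ - _ - (_ - _) = slope (h i) M t - slope (h i) n t).
    by rewrite (is_norm_distC _ _ _ normN (slope (h i) M t)).
  by rewrite opprB addrA subrK.
by move=> muD muU; exact: (growth_arith k01 mu0 UW U4 conv).
Qed.

(** Doubling the range of scales [p] times multiplies the gain, so that uniform
convexity at one scale yields a power of the number [2 ^ p] of scales, as in the
estimates of James for basic sequences. *)
Lemma slope_gap_iter K p (mu : R) : (0 < K)%N -> 0 <= mu ->
  (forall l, (l < 2 ^ p)%N ->
    mu < slope_gap (K ^ (2 ^ p)) (K ^ l) (K ^ l.+1)) ->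
  (1 + k) ^+ p * mu < slope_gap (K ^ (2 ^ p)) 1 (K ^ (2 ^ p)).
Proof.
have [k_gt0 k_le1] := andP k01.
move=> K_gt0 mu0; set L := (2 ^ p)%N => gapK.
suff H r l : (l + 2 ^ r <= L)%N ->
    (1 + k) ^+ r * mu < slope_gap (K ^ L) (K ^ l) (K ^ (l + 2 ^ r)).
  by have := H p 0%N; rewrite add0n expn0; apply.
elim: r l => [|r IHr] l lL.
  by rewrite expr0 mul1r addn1; apply: gapK; rewrite addn1 in lL.
have lr : (l + 2 ^ r.+1 = l + 2 ^ r + 2 ^ r)%N by rewrite expnS mul2n -addnn addnA.
rewrite lr in lL *; rewrite exprS -mulrA.
apply: (slope_gap_growth _ _ (K ^ (l + 2 ^ r))%N).
- by rewrite mulr_ge0// exprn_ge0//; lra.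
- by rewrite expn_gt0 K_gt0.
- by rewrite dvdn_exp2l// leq_addr.
- by rewrite dvdn_exp2l// leq_addr.
- by rewrite dvdn_exp2l.
- by apply: IHr; rewrite (leq_trans _ lL)// leq_addr.
- by apply: IHr.
Qed.

(** The total increment is bounded because [h] is Lipschitz, so one of the
[2 ^ p] increments between consecutive scales is small, on average over all
members of the family. Averaging in [t] then gives one position
that serves for the whole family. *)
Lemma coarse_differentiation K p (B : R) : (0 < K)%N ->
  (forall i t, N (h i t.+1 - h i t) <= B) ->
  exists l t, [/\ (l < 2 ^ p)%N, (t < K ^ (2 ^ p))%N &
    \sum_(i : I) N (slope (h i) (K ^ l) t - slope (h i) (K ^ l.+1) t) ^+ 2 <=
      #|I|%:R * (2 * B) ^+ 2 / (1 + k) ^+ p].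
Proof.
have [k_gt0 k_le1] := andP k01.
move=> K_gt0 hB; set L := (2 ^ p)%N; set T := (K ^ L)%N.
have [I0|/card_gt0P[i0 _]] := posnP #|I|.
  exists 0%N, 0%N; rewrite expn_gt0 /= expn_gt0 K_gt0; split=> //.
  by rewrite big_pred0 => [|i]; rewrite ?I0 ?mul0r//; have := card0_eq I0 i.
have B_ge0 : 0 <= B by apply: le_trans (hB i0 0%N); exact: is_norm_ge0.
have k1_gt0 : 0 < (1 + k) ^+ p by rewrite exprn_gt0//; lra.
have T_gt0 : (0 < T)%N by rewrite expn_gt0 K_gt0.
set mu := #|I|%:R * (2 * B) ^+ 2 / (1 + k) ^+ p.
have mu_ge0 : 0 <= mu by rewrite divr_ge0 ?mulr_ge0 ?sqr_ge0 ?ler0n// ltW.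
apply: contrapT => none.
have gaps l : (l < L)%N -> T%:R * mu < slope_gap T (K ^ l) (K ^ l.+1).
  move=> lL; rewrite /slope_gap exchange_big/= mulr_natl.
  have -> : mu *+ T = \sum_(0 <= t < T) mu by rewrite big_const_nat iter_addr addr0 subn0.
  rewrite !big_mkord; apply: ltr_sum => [|t _].
    by apply/hasP; exists (Ordinal T_gt0); rewrite ?mem_index_enum.
  by rewrite ltNge; apply/negP => small; apply: none; exists l, t.
have := slope_gap_iter K p (T%:R * mu) K_gt0 (mulr_ge0 (ler0n _ _) mu_ge0) gaps.
rewrite mulrCA mulrC [(1 + k) ^+ p * _]mulrC divfK ?gt_eqF//.
apply/negP; rewrite -leNgt.
apply: (@le_trans _ _ (\sum_(i : I) \sum_(0 <= t < T) (2 * B) ^+ 2)).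
  apply: ler_sum => i _; apply: ler_sum => t _.
  have N0 := is_norm_ge0 _ _ _ normN.
  rewrite lerXn2r// ?nnegrE//; first lra.
  apply: (le_trans (is_norm_ler_sub _ _ _ normN _ _)).
  rewrite [2 * B]mulr_natl mulr2n; apply: lerD.
    exact: (slope_bound (h i) B 1 t isT (hB i)).
  exact: (slope_bound (h i) B T t T_gt0 (hB i)).
set sq := (2 * B) ^+ 2; rewrite big_const_nat iter_addr addr0 subn0 sumr_const.
by rewrite -[sq *+ T]mulr_natl -[_ *+ #|_|]mulr_natl mulrA mulrAC.
Qed.

End Family.
End Slopes.
Arguments slope {R V} h n t.

(** * Commutators and word length in the Heisenberg group *)

Section CentralCommutator.
Local Open Scope group_scope.
Variables (G : groupType) (a b c : G).
Hypotheses (c_central : forall x, commute c x) (abc : a * b = c * (b * a)).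

Lemma commutator_expg m n : a ^+ m * b ^+ n = c ^+ (m * n) * (b ^+ n * a ^+ m).
Proof.
have cX k x : commute (c ^+ k) x by apply/commute_sym/commuteX/commute_sym.
have a1 k : a * b ^+ k = c ^+ k * (b ^+ k * a).
  elim: k => [|k IHk]; first by rewrite !expg0 !mul1g mulg1.
  rewrite expgS mulgA abc -mulgA -(mulgA b) IHk expgS -!mulgA; congr (c * _).
  by rewrite !mulgA (cX k b).
elim: m => [|m IHm]; first by rewrite mul0n !expg0 !mul1g mulg1.
rewrite expgS -mulgA IHm mulgA -(cX _ a) -mulgA mulgA mulgA -(mulgA _ a) a1.
by rewrite mulSn addnC expgnDr -!mulgA.
Qed.

Lemma conj_expg m n : a ^+ m * b ^+ n * (a ^+ m)^-1 = c ^+ (m * n) * b ^+ n.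
Proof. by rewrite commutator_expg -!mulgA mulgV mulg1. Qed.

Lemma conjV_expg m n :
  (a ^+ m)^-1 * b ^+ n * a ^+ m = (c ^+ (m * n))^-1 * b ^+ n.
Proof.
apply: (mulgI (a ^+ m)); rewrite -!mulgA mulVKg.
apply: (mulgI (c ^+ (m * n))).
rewrite -commutator_expg mulgA.
have -> : c ^+ (m * n) * a ^+ m = a ^+ m * c ^+ (m * n).
  by apply/commute_sym/commuteX/commute_sym/c_central.
by rewrite -mulgA mulVKg.
Qed.

End CentralCommutator.

Section WordLength.
Local Open Scope group_scope.

Definition heis_c : heis := heis_a * heis_b * heis_a^-1 * heis_b^-1.

Lemma word_length_le x n : is_product_of_length heis_S x n ->
  (word_length x <= n)%N.
Proof. by move=> xn; rewrite /word_length; case: ex_minnP => k _; apply; apply/asboolP. Qed.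

Lemma word_lengthP x : is_product_of_length heis_S x (word_length x).
Proof. by rewrite /word_length; case: ex_minnP => k /asboolP. Qed.

Lemma word_length1 : word_length 1 = 0%N.
Proof. by apply/eqP; rewrite -leqn0; apply: word_length_le; exists [::]; rewrite big_nil. Qed.

Lemma word_lengthM x y :
  (word_length (x * y)%g <= word_length x + word_length y)%N.
Proof.
have [s [<- sS sx]] := word_lengthP x; have [t [<- tS ty]] := word_lengthP y.
apply: word_length_le; exists (s ++ t); split; first exact: size_cat.
  by move=> g; rewrite mem_cat => /orP[/sS|/tS].
by rewrite big_cat sx ty.
Qed.

Lemma heis_S_inv x : x \in heis_S -> x^-1 \in heis_S.
Proof.
by rewrite !inE => /or4P[] /eqP ->; rewrite ?invgK ?eqxx ?orbT.
Qed.

Lemma word_lengthV x : word_length x^-1 = word_length x.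
Proof.
suff le y : (word_length y^-1%g <= word_length y)%N.
  by apply/eqP; rewrite eqn_leq le -{1}[x]invgK le.
have [s [<- sS <-]] := word_lengthP y.
elim: s sS => [|g s IHs] sS; first by rewrite big_nil invg1 word_length1.
rewrite big_cons invgM (leq_trans (word_lengthM _ _))//= -addn1 leq_add//.
  by apply: IHs => h hs; apply: sS; rewrite inE hs orbT.
apply: word_length_le; exists [:: g^-1]; split=> //; last by rewrite big_seq1.
by move=> h; rewrite inE => /eqP ->; apply/heis_S_inv/sS; rewrite inE eqxx.
Qed.

Lemma word_length_gen x : x \in heis_S -> (word_length x <= 1)%N.
Proof.
move=> xS; apply: word_length_le; exists [:: x]; split=> //; last by rewrite big_seq1.
by move=> y; rewrite inE => /eqP ->.
Qed.

Lemma word_lengthX x n : (word_length x <= 1)%N -> (word_length (x ^+ n)%g <= n)%N.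
Proof.
move=> x1; elim: n => [|n IHn]; first by rewrite expg0 word_length1.
by rewrite expgS (leq_trans (word_lengthM _ _))// -add1n leq_add.
Qed.

Lemma word_length_a : (word_length heis_a <= 1)%N.
Proof. by apply: word_length_gen; rewrite !inE eqxx. Qed.

Lemma word_length_b : (word_length heis_b <= 1)%N.
Proof. by apply: word_length_gen; rewrite !inE eqxx ?orbT. Qed.

Lemma d_W_mulr x g : d_W x (x * g) = word_length g.
Proof. by rewrite /d_W mulKg. Qed.

Lemma heis_of_catM u v : heis_of (u ++ v) = heis_of u * heis_of v.
Proof. exact: heis_of_cat. Qed.

Lemma heis_of_inv (g : bool) :
  heis_of [:: (g, true)] = (heis_of [:: (g, false)])^-1.
Proof.
apply: (mulgI (heis_of [:: (g, false)])); rewrite mulgV.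
by rewrite -heis_of_catM; exact/heis_ofP/(heis_cancel (g, false)).
Qed.

Lemma heis_cE : heis_c = heis_of commutator_word.
Proof.
rewrite (heis_of_catM [:: letter_a; letter_b; letter_inv letter_a] [:: _]).
rewrite (heis_of_catM [:: letter_a; letter_b] [:: _]).
by rewrite (heis_of_catM [:: letter_a] [:: _]) /letter_inv/= !heis_of_inv.
Qed.

Lemma heis_c_central x : commute heis_c x.
Proof.
rewrite /commute heis_cE -[x]heis_ofK -!heis_of_catM.
exact/heis_ofP/heis_central.
Qed.

Lemma heis_abc : heis_a * heis_b = heis_c * (heis_b * heis_a).
Proof. by rewrite /heis_c !mulgA mulgVK mulgVK. Qed.

(** [heis_b], [heis_a], [heis_c^-1] satisfy the same relations as [heis_a],
[heis_b], [heis_c], so a fact about one generator transfers to the other. *)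
Lemma heis_bac : heis_b * heis_a = heis_c^-1 * (heis_a * heis_b).
Proof. by rewrite heis_abc mulKg. Qed.

Lemma heis_cV_central x : commute heis_c^-1 x.
Proof. by apply/commute_sym/commuteV/commute_sym/heis_c_central. Qed.

Lemma word_length_central m n :
  (word_length (heis_c ^+ (m * n)%N)%g <= 2 * (m + n))%N.
Proof.
have -> : heis_c ^+ (m * n)%N =
    heis_a ^+ m * heis_b ^+ n * (heis_a ^+ m)^-1 * (heis_b ^+ n)^-1.
  by rewrite (conj_expg _ _ _ _ heis_c_central heis_abc) mulgK.
have la := word_lengthX _ m word_length_a; have lb := word_lengthX _ n word_length_b.
rewrite mul2n -addnn addnA.
apply: leq_trans (word_lengthM _ _) _; rewrite word_lengthV; apply: leq_add => //.
apply: leq_trans (word_lengthM _ _) _; rewrite word_lengthV; apply: leq_add => //.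
by apply: leq_trans (word_lengthM _ _) _; apply: leq_add.
Qed.

(** Vertical distances are square roots: [r = u * k + v] with [u, v <= k] splits
the exponent into two products, each of them the area of a rectangle whose sides
are at most [k * n]. *)
Lemma word_length_central_sqr k n r : (0 < k)%N -> (r <= k * k)%N ->
  (word_length (heis_c ^+ (r * n * n)%N)%g <= 6 * k * n)%N.
Proof.
move=> k_gt0 rk; have u_le : (r %/ k <= k)%N by rewrite -[X in (_ <= X)%N](mulnK k k_gt0) leq_div2r.
have v_lt : (r %% k < k)%N by rewrite ltn_mod.
have -> : (r * n * n = (k * n) * ((r %/ k) * n) + ((r %% k) * n) * n)%N.
  by rewrite {1}(divn_eq r k); nia.
rewrite expgnDr (leq_trans (word_lengthM _ _))//.
apply: leq_trans (leq_add (word_length_central _ _) (word_length_central _ _)) _.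
nia.
Qed.

Lemma word_length_cV_sqr kappa n r : (0 < kappa)%N -> (r <= kappa * kappa)%N ->
  (word_length (heis_c^-1 ^+ (r * n * n)%N)%g <= 6 * kappa * n)%N.
Proof.
move=> kappa_gt0 rk; rewrite expVgn word_lengthV.
exact: word_length_central_sqr.
Qed.

End WordLength.

(** * Lower bound for the length of central elements *)

Section Area.
Local Open Scope ring_scope.

(** Right multiplication by a letter in the coordinates [a^i b^j c^k]. *)
Definition letter_act (s : int * int * int) (l : letter) : int * int * int :=
  let: (i, j, k) := s in
  let e : int := if l.2 then -1 else 1 in
  if l.1 then (i, j + e, k) else (i + e, j, k - e * j).

Definition word_act (w : word) s := foldl letter_act s w.

Definition shift_center (n : int) (s : int * int * int) :=
  let: (i, j, k) := s in (i, j, k + n).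

Lemma word_act_shift w n s : word_act w (shift_center n s) = shift_center n (word_act w s).
Proof.
elim: w s => //= l w IHw [[i j] k]; rewrite -IHw; congr (word_act w _).
by case: l => [[] e] /=; congr (_, _); ring.
Qed.

Lemma word_act_commutator s : word_act commutator_word s = shift_center 1 s.
Proof. by case: s => [[i j] k] /=; congr (_, _, _); ring. Qed.

Lemma word_act_eqv u v : heis_eqv u v -> word_act u =1 word_act v.
Proof.
elim=> {u v} [//|u v _ IH s|v u w _ IHu _ IHv s|u1 u2 v1 v2 _ IHu _ IHv s|l [[i j] k]|w s].
- by rewrite IH.
- by rewrite IHu.
- by rewrite /word_act !foldl_cat -/(word_act _ _) -/(word_act _ _) IHu [LHS]IHv.
- by case: l => [[] []] /=; congr (_, _, _); ring.
- rewrite /word_act !foldl_cat -!/(word_act _ _).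
  by rewrite !word_act_commutator word_act_shift.
Qed.

Lemma word_act_bound w : let: (i, j, k) := word_act w (0, 0, 0) in
  `|j| <= (size w)%:Z /\ `|k| <= ((size w) * (size w))%N%:Z.
Proof.
elim/last_ind: w => [//|w l]; rewrite /word_act foldl_rcons -/(word_act _ _) size_rcons.
case: (word_act w (0, 0, 0)) => [[i j] k] [jw kw].
by case: l => [[] []] /=; split; nia.
Qed.

Lemma word_length_word x : exists2 w, heis_of w = x & size w = word_length x.
Proof.
have [s [<- sS <-]] := word_lengthP x.
elim: s sS => [|g s IHs] sS; first by exists [::]; rewrite ?big_nil.
have [w ws wsz] : exists2 w, heis_of w = \big[*%g/1%g]_(g <- s) g & size w = size s.
  by apply: IHs => h hs; apply: sS; rewrite inE hs orbT.
have [l lg] : exists l, heis_of [:: l] = g.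
  have : g \in heis_S by apply: sS; rewrite inE eqxx.
  rewrite !inE => /or4P[] /eqP ->; [exists letter_a|exists letter_b|
    exists (letter_inv letter_a)|exists (letter_inv letter_b)] => //; exact: heis_of_inv.
by exists (l :: w); rewrite /= ?wsz// big_cons -ws -lg -heis_of_catM.
Qed.

(** A word of length [n] moves the first two coordinates by at most [n], and
each letter changes the central coordinate by at most the second one, so the
central coordinate is at most [n ^ 2]. *)
Lemma word_length_center_ge n : (n <= word_length (heis_c ^+ (n * n)%N)%g)%N.
Proof.
have [w wc <-] := word_length_word (heis_c ^+ (n * n)%N)%g.
pose cw := flatten (nseq (n * n) commutator_word).
have cwE : heis_of cw = (heis_c ^+ (n * n)%N)%g.
  rewrite /cw; elim: (n * n)%N => [|k IHk] //.
  by rewrite /= expgS -IHk heis_cE -heis_of_catM.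
have cw_act : word_act cw (0, 0, 0) = (0, 0, (n * n)%:Z).
  rewrite /cw; elim: (n * n)%N => [//|k IHk].
  have -> : flatten (nseq k.+1 commutator_word) =
      commutator_word ++ flatten (nseq k commutator_word) by [].
  rewrite {1}/word_act foldl_cat -!/(word_act _ _).
  by rewrite word_act_commutator word_act_shift IHk /shift_center; congr (_, _); lia.
have := word_act_bound w.
rewrite (word_act_eqv w cw) ?cw_act; last by apply/heis_ofP; rewrite wc.
by move=> [_]; nia.
Qed.

End Area.

(** * Averaging over boxes of the Heisenberg group *)

Section Box.
Variable R : realType.
Local Open Scope nat_scope.

Lemma ler_sum_shift (F : nat -> R) s n n' : (forall i, (0 <= F i)%R) -> n + s <= n' ->
  (\sum_(0 <= i < n) F (i + s)%N <= \sum_(0 <= i < n') F i)%R.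
Proof.
move=> F0 nn'; rewrite (@big_cat_nat _ _ _ s 0 n')//; last by rewrite (leq_trans _ nn')// leq_addl.
rewrite (@big_cat_nat _ _ _ (n + s) s n')//=; last exact: leq_addl.
have -> : (\sum_(0 <= i < n) F (i + s)%N = \sum_(s <= i < n + s) F i)%R.
  by rewrite -{2}(add0n s) big_addn addnK.
rewrite addrCA lerDl addr_ge0// ?sumr_ge0//.
Qed.

Definition box_sum n1 n2 n3 (F : nat -> nat -> nat -> R) : R :=
  (\sum_(0 <= i < n1) \sum_(0 <= j < n2) \sum_(0 <= k < n3) F i j k)%R.

Lemma ler_box_sum_shift F s1 s2 (g : nat -> nat) m1 m2 m3 n1 n2 n3 :
  (forall i j k, (0 <= F i j k)%R) ->
  m1 + s1 <= n1 -> m2 + s2 <= n2 -> (forall j, j < m2 -> m3 + g j <= n3) ->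
  (box_sum m1 m2 m3 (fun i j k => F (i + s1)%N (j + s2)%N (k + g j)%N)
    <= box_sum n1 n2 n3 F)%R.
Proof.
move=> F0 h1 h2 h3.
pose G j k := (\sum_(0 <= i < n1) F i j k)%R.
have F2 i j : (0 <= \sum_(0 <= k < n3) F i j k)%R by rewrite sumr_ge0.
apply: le_trans (ler_sum_shift _ _ _ _ _ h1); last by move=> i; rewrite sumr_ge0.
apply: ler_sum => i _.
apply: le_trans (ler_sum_shift _ _ _ _ (F2 (i + s1)) h2).
rewrite !big_mkord; apply: ler_sum => j _; exact: ler_sum_shift (h3 _ (ltn_ord j)).
Qed.

Local Open Scope group_scope.

Definition box_point (i j k : nat) : heis :=
  heis_a ^+ i * heis_b ^+ j * heis_c ^+ k.

Lemma heis_c_comm k x : heis_c ^+ k * x = x * heis_c ^+ k.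
Proof. exact/commute_sym/commuteX/commute_sym/heis_c_central. Qed.

Lemma box_point_mul_b i j k s :
  box_point i j k * heis_b ^+ s = box_point i (j + s)%N k.
Proof. by rewrite /box_point -mulgA heis_c_comm mulgA expgnDr !mulgA. Qed.

Lemma box_point_mul_a i j k s :
  box_point i j (k + s * j)%N * heis_a ^+ s = box_point (i + s)%N j k.
Proof.
rewrite /box_point -mulgA heis_c_comm [(k + _)%N]addnC !expgnDr.
rewrite -(mulgA _ (heis_a ^+ s)) (commutator_expg _ _ _ _ heis_c_central heis_abc s j).
by rewrite [heis_c ^+ (s * j)%N * (_ * _)]heis_c_comm !mulgA.
Qed.

Local Open Scope ring_scope.

(** If [phi + psi] is small on average over the box of sides [3 T], [3 T], [6 T^2],
some [z] makes it small at four points that lie on given lines near [z]. As [z]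
runs over an inner box of sides [T], [T], [T^2], each of the four points runs
injectively over a part of the large box, which is 54 times as large as the
inner one; and [phi], [psi] are each summed twice, whence the factor 108. *)
Lemma box_choice (phi psi : heis -> R) (T S n : nat) (E : R) :
  (forall x, 0 <= phi x) -> (forall x, 0 <= psi x) ->
  (0 < T)%N -> (S <= T)%N -> (n <= T)%N ->
  box_sum (3 * T)%N (3 * T)%N (6 * (T * T))%N (fun i j k =>
    phi (box_point i j k) + psi (box_point i j k)) <=
    (3 * T * (3 * T) * (6 * (T * T)))%N%:R * E ->
  exists z x1 x2 x3 x4 : heis,
    [/\ [/\ (x1 * heis_a ^+ S = z)%g, (x2 * heis_a ^+ S = z * heis_b ^+ n)%g,
         (x3 * heis_b ^+ S = z)%g & (x4 * heis_b ^+ S = z * heis_a ^+ n)%g] &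
      phi x1 + phi x2 + (psi x3 + psi x4) <= 108 * E].
Proof.
move=> phi0 psi0 T_gt0 ST nT; set Psi := box_sum _ _ _ _ => PsiE.
apply: contrapT => none.
(* The four points for [z = a^(i + T) b^(j + T) c^(k + 2 T^2)]; the offsets
   keep all exponents nonnegative. *)
pose p1 (i j k : nat) := box_point (i + (T - S))%N (j + T)%N (k + (2 * (T * T) + S * (j + T)))%N.
pose p2 (i j k : nat) := box_point (i + (T - S))%N (j + (T + n))%N (k + (2 * (T * T) + S * (j + (T + n))))%N.
pose p3 (i j k : nat) := box_point (i + T)%N (j + (T - S))%N (k + 2 * (T * T))%N.
pose p4 (i j k : nat) := box_point (i + (T + n))%N (j + (T - S))%N (k + (2 * (T * T) - n * (j + T)))%N.
have big i j k : (i < T)%N -> (j < T)%N ->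
    108 * E < (phi (p1 i j k) + phi (p2 i j k)) + (psi (p3 i j k) + psi (p4 i j k)).
  move=> iT jT; rewrite ltNge; apply/negP => small; apply: none.
  have shiftTS q : (q + (T - S) + S = q + T)%N by rewrite -addnA subnK.
  exists (box_point (i + T)%N (j + T)%N (k + 2 * (T * T))%N).
  exists (p1 i j k), (p2 i j k), (p3 i j k), (p4 i j k); split=> //.
  rewrite /p1 /p2 /p3 /p4 !addnA; split.
  - by rewrite box_point_mul_a shiftTS.
  - by rewrite box_point_mul_a shiftTS box_point_mul_b.
  - by rewrite box_point_mul_b shiftTS.
  - rewrite box_point_mul_b shiftTS -box_point_mul_a; congr (box_point _ _ _ * _)%g.
    by rewrite -addnA subnK//; nia.
have shift (F : heis -> R) s1 s2 (g : nat -> nat) : (forall x, 0 <= F x) ->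
    (T + s1 <= 3 * T)%N -> (T + s2 <= 3 * T)%N ->
    (forall j, j < T -> T * T + g j <= 6 * (T * T))%N ->
    box_sum T T (T * T)%N
      (fun i j k => F (box_point (i + s1)%N (j + s2)%N (k + g j)%N)) <=
    box_sum (3 * T)%N (3 * T)%N (6 * (T * T))%N (fun i j k => F (box_point i j k)).
  move=> F0 h1 h2 h3.
  by apply: (ler_box_sum_shift (fun i j k => F (box_point i j k))).
have S1 := shift phi (T - S)%N T (fun j => 2 * (T * T) + S * (j + T))%N phi0.
have S2 := shift phi (T - S)%N (T + n)%N (fun j => 2 * (T * T) + S * (j + (T + n)))%N phi0.
have S3 := shift psi T (T - S)%N (fun=> 2 * (T * T))%N psi0.
have S4 := shift psi (T + n)%N (T - S)%N (fun j => 2 * (T * T) - n * (j + T))%N psi0.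
have {}S1 := S1 ltac:(lia) ltac:(lia) ltac:(move=> *; nia).
have {}S2 := S2 ltac:(lia) ltac:(lia) ltac:(move=> *; nia).
have {}S3 := S3 ltac:(lia) ltac:(lia) ltac:(move=> *; nia).
have {}S4 := S4 ltac:(lia) ltac:(lia) ltac:(move=> *; nia).
have boxD n1 n2 n3 F G : box_sum n1 n2 n3 (fun i j k => F i j k + G i j k) =
    box_sum n1 n2 n3 F + box_sum n1 n2 n3 G.
  rewrite /box_sum -big_split/=; apply: eq_bigr => i _.
  rewrite -big_split/=; apply: eq_bigr => j _; exact: big_split.
have box_lt n1 n2 n3 F G : (0 < n1)%N -> (0 < n2)%N -> (0 < n3)%N ->
    (forall i j k, (i < n1)%N -> (j < n2)%N -> F i j k < G i j k) ->
    box_sum n1 n2 n3 F < box_sum n1 n2 n3 G.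
  move=> n1_gt0 n2_gt0 n3_gt0 FG; rewrite /box_sum.
  apply: ltr_sum_nat => // i /andP[_ i1].
  apply: ltr_sum_nat => // j /andP[_ j2].
  by apply: ltr_sum_nat => // k _; exact: FG.
have : box_sum T T (T * T)%N (fun _ _ _ => 108 * E) <
    box_sum T T (T * T)%N (fun i j k =>
     (phi (p1 i j k) + phi (p2 i j k)) + (psi (p3 i j k) + psi (p4 i j k))).
  by apply: box_lt; rewrite ?muln_gt0 ?T_gt0// => i j k; exact: big.
rewrite !boxD.
have -> : box_sum T T (T * T)%N (fun _ _ _ => 108 * E) = (T * (T * (T * T)))%N%:R * (108 * E).
  by rewrite /box_sum !big_const_nat !iter_addr !addr0 !subn0 -!mulrnA [in RHS]mulr_natl; congr (_ *+ _); lia.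
move: PsiE; rewrite /Psi boxD !natrM; nra.
Qed.

End Box.

(** * Collapse of the center *)

Section Collapse.
Variables (R : realType) (V : lmodType R) (N : V -> R).
Hypothesis normN : is_norm N.

Lemma slope_transfer (s K e Q : R) (u1 u2 B1 B2 : V) : 0 < s -> 0 < K ->
  N (s^-1 *: u1 - (s * K)^-1 *: B1) <= e ->
  N (s^-1 *: u2 - (s * K)^-1 *: B2) <= e ->
  N (B2 - B1) <= Q -> N (u2 - u1) <= 2 * (s * e) + Q / K.
Proof.
move=> s_gt0 K_gt0 e1 e2 BQ.
have uE (u B : V) : u = s *: (s^-1 *: u - (s * K)^-1 *: B) + K^-1 *: B.
  rewrite scalerBr !scalerA divff ?gt_eqF// scale1r invfM mulrA divff ?gt_eqF//.
  by rewrite mul1r subrK.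
rewrite (uE u1 B1) (uE u2 B2) opprD addrACA -!scalerBr.
apply: (le_trans (is_norm_ler_add _ _ _ normN _ _)).
rewrite !(is_normZ _ _ _ normN) !ger0_norm ?invr_ge0 ?(ltW s_gt0) ?(ltW K_gt0)//.
rewrite [Q / K]mulrC; apply: lerD; last by rewrite ler_wpM2l// invr_ge0 ltW.
rewrite mulrCA; apply: ler_wpM2l; first exact: ltW.
by apply: (le_trans (is_norm_ler_sub _ _ _ normN _ _)); lra.
Qed.

Variable f : heis -> V.

Definition line (g : heis) (m : nat) (x : heis) (t : nat) : V := f (x * g ^+ (m * t)%N)%g.

(** The size of the martingale increment between the scales [K ^ l] and [K ^ l.+1] at [t], in
the line through [x] in the direction [g]. *)
Definition slope_jump (g : heis) (m K l t : nat) (x : heis) : R :=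
  N (slope (line g m x) (K ^ l) t - slope (line g m x) (K ^ l.+1) t).

(** The increment rewritten around the current point [z] of the line: [w] is the
start of the long interval that contains [z]. *)
Lemma slope_jumpE g m K l t x z : (0 < K)%N ->
  (x * g ^+ (t %/ K ^ l * (m * K ^ l))%N = z)%g ->
  exists2 w, (w * g ^+ ((t %/ K ^ l %% K) * (m * K ^ l))%N = z)%g &
    slope_jump g m K l t x =
      N ((K ^ l)%:R^-1 *: (f (z * g ^+ (m * K ^ l)%N)%g - f z) -
         ((K ^ l)%:R * K%:R)^-1 *: (f (w * g ^+ (K * (m * K ^ l))%N)%g - f w)).
Proof.
move=> K_gt0 xz; set n := (m * K ^ l)%N; set q := (t %/ K ^ l)%N.
exists (x * g ^+ (q %/ K * (K * n))%N)%g.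
  rewrite -xz -mulgA -expgnDr mulnA -mulnDl -/n -/q.
  by rewrite -divn_eq.
rewrite /slope_jump /slope -natrM -expnSr; congr (N (_ *: (_ - _) - _ *: (_ - _))).
- rewrite /line -xz -mulgA -expgnDr -/n -/q; congr (f (x * g ^+ _)%g).
  by rewrite mulnCA -/n mulSnr.
- by rewrite /line -xz -/n -/q; congr (f (x * g ^+ _)%g); rewrite mulnCA.
- rewrite /line -mulgA -expgnDr; congr (f (x * g ^+ _)%g).
  rewrite expnSr divnMA -/q mulnA [(m * _)%N]mulnC /n.
  nia.
- rewrite /line; congr (f (x * g ^+ _)%g); rewrite expnSr divnMA -/q /n; nia.
Qed.

Variable beta : R.
Hypothesis beta_ge0 : 0 <= beta.
Hypothesis f_lip : forall x g, N (f (x * g)%g - f x) <= beta * (word_length g)%:R.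

Section Direction.
Variables a b c : heis.
Hypotheses (c_central : forall x, commute c x) (abc : (a * b = c * (b * a))%g).
Hypothesis b_len : (word_length b <= 1)%N.

Variable kappa : nat.
Hypothesis kappa_gt0 : (0 < kappa)%N.
Hypothesis c_len : forall n r, (r <= kappa * kappa)%N ->
  (word_length (c ^+ (r * n * n)%N)%g <= 6 * kappa * n)%N.

(** Two lines in the direction [a] that are [b^n] apart at time [r n] differ, all
along a length [kappa^2 n], by [b^n] times a central element of exponent at most
[(kappa n)^2]. Their distance is of order [kappa * n], smaller than the length by
a factor [kappa]. *)
Lemma parallel_increments n r w w' : (r <= kappa * kappa)%N ->
  (w' * a ^+ (r * n)%N = w * a ^+ (r * n)%N * b ^+ n)%g ->
  N ((f (w' * a ^+ (kappa * kappa * n)%N)%g - f w') -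
     (f (w * a ^+ (kappa * kappa * n)%N)%g - f w)) <= 14 * beta * kappa%:R * n%:R.
Proof.
move=> rK ww'.
have len7 g : (word_length g <= 6 * kappa * n)%N ->
    (word_length (g * b ^+ n)%g <= 7 * kappa * n)%N.
  move=> gn; apply: leq_trans (word_lengthM _ _) _.
  have := word_lengthX _ n b_len; nia.
have w'E : w' = (w * (c ^+ (r * n * n)%N * b ^+ n))%g.
  rewrite -(conj_expg _ _ _ _ c_central abc) !mulgA.
  by rewrite -ww' mulgK.
have w'K : (w' * a ^+ (kappa * kappa * n)%N = w * a ^+ (kappa * kappa * n)%N *
    ((c ^+ ((kappa * kappa - r) * n * n)%N)^-1 * b ^+ n))%g.
  rewrite -(conjV_expg _ _ _ _ c_central abc).
  have -> : (kappa * kappa * n = r * n + (kappa * kappa - r) * n)%N.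
    by rewrite -mulnDl subnKC.
  by rewrite expgnDr !mulgA ww' mulgK.
rewrite opprD opprK addrACA [- f w' + _]addrC.
apply: (le_trans (is_norm_ler_add _ _ _ normN _ _)).
have half x y g : (word_length g <= 7 * kappa * n)%N -> y = (x * g)%g ->
    N (f y - f x) <= 7 * beta * kappa%:R * n%:R.
  move=> g7 ->; apply: le_trans (f_lip _ _) _.
  have -> : 7 * beta * kappa%:R * n%:R = beta * (7 * kappa * n)%N%:R by rewrite !natrM; ring.
  by rewrite ler_wpM2l// ler_nat.
rewrite (is_norm_distC _ _ _ normN (f w)).
have := half _ _ _ (len7 _ (c_len n r rK)) w'E.
have := half _ _ _ (len7 _ _) w'K; rewrite word_lengthV => /(_ (c_len _ _ (leq_subr _ _))).
lra.
Qed.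

End Direction.
Lemma line_step g m x t : (word_length g <= 1)%N ->
  N (line g m x t.+1 - line g m x t) <= beta * m%:R.
Proof.
move=> g1; rewrite /line mulnS addnC expgnDr mulgA; apply: le_trans (f_lip _ _) _.
by rewrite ler_wpM2l// ler_nat; exact: word_lengthX.
Qed.

Variable k : R.
Hypotheses (k01 : 0 < k <= 1) (convN : forall x y,
    N (x + y) ^+ 2 + k * (8 * N (x - y) ^+ 2 - (N x ^+ 2 + N y ^+ 2)) <=
    2 * (N x ^+ 2 + N y ^+ 2)).

(** Coarse differentiation for the family of all [a]-lines and [b]-lines through
a box, followed by the choice of a good square with corner [z]. *)
Lemma small_jumps m K p : (0 < m)%N -> (0 < K)%N ->
  exists l t z x1 x2 x3 x4, let n := (m * K ^ l)%N in let S := (t %/ K ^ l * n)%N in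
    [/\ (l < 2 ^ p)%N,
        [/\ (x1 * heis_a ^+ S = z)%g, (x2 * heis_a ^+ S = z * heis_b ^+ n)%g,
         (x3 * heis_b ^+ S = z)%g & (x4 * heis_b ^+ S = z * heis_a ^+ n)%g] &
        slope_jump heis_a m K l t x1 ^+ 2 + slope_jump heis_a m K l t x2 ^+ 2 +
        (slope_jump heis_b m K l t x3 ^+ 2 + slope_jump heis_b m K l t x4 ^+ 2) <=
        216 * ((2 * (beta * m%:R)) ^+ 2 / (1 + k) ^+ p)].
Proof.
move=> m_gt0 K_gt0; pose T := (m * K ^ (2 ^ p))%N.
have T_gt0 : (0 < T)%N by rewrite /T muln_gt0 m_gt0 expn_gt0 K_gt0.
pose I : finType := (bool * ('I_(3 * T) * ('I_(3 * T) * 'I_(6 * (T * T)))))%type.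
pose h (i : I) := line (if i.1 then heis_b else heis_a) m (box_point i.2.1 i.2.2.1 i.2.2.2).
have h_step i t : N (h i t.+1 - h i t) <= beta * m%:R.
  by apply: line_step; case: i.1; [exact: word_length_b|exact: word_length_a].
have [l [t [lL tT]]] := coarse_differentiation _ _ _ normN _ k01 convN I h K p _ K_gt0 h_step.
set E := (2 * (beta * m%:R)) ^+ 2 / (1 + k) ^+ p; rewrite -mulrA -/E => hE.
have ST : (t %/ K ^ l * (m * K ^ l) <= T)%N.
  rewrite mulnCA leq_mul2l; apply/orP; right.
  by apply: leq_trans (ltnW tT); exact: leq_trunc_div.
have nT : (m * K ^ l <= T)%N.
  by rewrite leq_mul2l; apply/orP; right; rewrite leq_pexp2l// ltnW.
have boxE : box_sum R (3 * T)%N (3 * T)%N (6 * (T * T))%N (fun i j k' =>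
    slope_jump heis_a m K l t (box_point i j k') ^+ 2 +
    slope_jump heis_b m K l t (box_point i j k') ^+ 2) <=
    (3 * T * (3 * T) * (6 * (T * T)))%N%:R * (2 * E).
  have -> : (3 * T * (3 * T) * (6 * (T * T)))%N%:R * (2 * E) = #|I|%:R * E.
    by rewrite !card_prod card_bool !card_ord !natrM; ring.
  apply: le_trans hE; rewrite le_eqVlt; apply/orP; left; apply/eqP; symmetry.
  pose G (d : bool) (q : 'I_(3 * T) * ('I_(3 * T) * 'I_(6 * (T * T)))) : R :=
    slope_jump (if d then heis_b else heis_a) m K l t (box_point q.1 q.2.1 q.2.2) ^+ 2.
  transitivity (\sum_d \sum_q G d q); first by rewrite pair_bigA.
  rewrite big_bool/= addrC -big_split/= /box_sum big_mkord.
  rewrite -(pair_bigA _ (fun i q => G false (i, q) + G true (i, q)))/=.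
  apply: eq_bigr => i _; rewrite big_mkord.
  rewrite -(pair_bigA _ (fun j k' => G false (i, (j, k')) + G true (i, (j, k'))))/=.
  by apply: eq_bigr => j _; rewrite big_mkord.
have [||z [x1 [x2 [x3 [x4 [xz jumps]]]]]] := box_choice R
  (fun x => slope_jump heis_a m K l t x ^+ 2) (fun x => slope_jump heis_b m K l t x ^+ 2)
  T _ _ _ _ _ T_gt0 ST nT boxE.
- by move=> x; exact: sqr_ge0.
- by move=> x; exact: sqr_ge0.
by exists l, t, z, x1, x2, x3, x4; split=> //; rewrite mulrA -natrM in jumps.
Qed.

(** The increments of [f] along [a^n] at [z] and at [z b^n] are close: each is
close to the corresponding increment at the scale [K * n], rescaled, and those
two have slopes differing by at most the order of [1 / kappa], because the long
lines stay near each other.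
The same holds with [a] and [b] exchanged. Adding the two comparisons around the
square with corner [z], the values at [z], [z a^n] and [z b^n] cancel, and
[f (z a^n b^n)] is close to [f (z b^n a^n)], although these two points differ by
[c^(n^2)]. *)
Lemma center_collapse m p rho : (0 < m)%N -> 2^-1 <= rho -> rho ^+ 2 * (1 + k) = 1 ->
  exists n z, [/\ (m <= n)%N, (n <= m * (2 ^ p * 2 ^ p) ^ (2 ^ p))%N &
    N (f (z * heis_c ^+ (n * n)%N)%g - f z) <= 148 * beta * n%:R * rho ^+ p].
Proof.
move=> m_gt0 rho_ge rhok; pose kappa := (2 ^ p)%N.
have kappa_gt0 : (0 < kappa)%N by rewrite expn_gt0.
pose K := (kappa * kappa)%N; have K_gt0 : (0 < K)%N by rewrite muln_gt0 kappa_gt0.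
have [k_gt0 k_le1] := andP k01.
have [l [t [z [x1 [x2 [x3 [x4 /= [lL [xz1 xz2 xz3 xz4] jumps]]]]]]]] :=
  small_jumps m K p m_gt0 K_gt0.
set n := (m * K ^ l)%N in xz1 xz2 xz3 xz4.
have Kl_gt0 : (0 < K ^ l)%N by rewrite expn_gt0 K_gt0.
(* [15 ^ 2 = 225] exceeds the 216 of [small_jumps]. *)
pose e := 15 * (2 * (beta * m%:R)) * rho ^+ p.
have rho_gt0 : 0 < rho by lra.
have e_ge0 : 0 <= e by rewrite !mulr_ge0// exprn_ge0// ltW.
have eE : 216 * ((2 * (beta * m%:R)) ^+ 2 / (1 + k) ^+ p) <= e ^+ 2.
  have -> : e ^+ 2 = 225 * ((2 * (beta * m%:R)) ^+ 2 / (1 + k) ^+ p).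
    rewrite /e exprMn -exprM mulnC exprM.
    have -> : rho ^+ 2 = (1 + k)^-1.
      by apply: (mulIf (x := 1 + k)); rewrite ?rhok ?mulVf// gt_eqF//; lra.
    by rewrite exprVn; ring.
  by rewrite ler_wpM2r ?ler_nat// divr_ge0 ?sqr_ge0// exprn_ge0//; lra.
have jump_le g x : slope_jump g m K l t x ^+ 2 <= e ^+ 2 ->
    slope_jump g m K l t x <= e.
  by rewrite ler_pXn2r// ?nnegrE// /slope_jump; exact: is_norm_ge0.
have J1 : slope_jump heis_a m K l t x1 <= e.
  by apply: jump_le; apply: le_trans eE; apply: le_trans jumps; rewrite -addrA lerDl !addr_ge0// sqr_ge0.
have J2 : slope_jump heis_a m K l t x2 <= e.
  apply: jump_le; apply: le_trans eE; apply: le_trans jumps.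
  by rewrite -addrA addrCA lerDl !addr_ge0// sqr_ge0.
have J3 : slope_jump heis_b m K l t x3 <= e.
  apply: jump_le; apply: le_trans eE; apply: le_trans jumps.
  by rewrite addrCA lerDl !addr_ge0// sqr_ge0.
have J4 : slope_jump heis_b m K l t x4 <= e.
  apply: jump_le; apply: le_trans eE; apply: le_trans jumps.
  by rewrite addrA lerDr !addr_ge0// sqr_ge0.
set r := (t %/ K ^ l %% K)%N.
have rK : (r <= kappa * kappa)%N by rewrite ltnW// ltn_mod.
have KlR : 0 < (K ^ l)%:R :> R by rewrite ltr0n.
have KR : 0 < K%:R :> R by rewrite ltr0n.
have bound : 2 * ((K ^ l)%:R * e) + 14 * beta * kappa%:R * n%:R / K%:R <=
    74 * beta * n%:R * rho ^+ p.
  have kappaR : 0 < kappa%:R :> R by rewrite ltr0n.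
  have -> : 2 * ((K ^ l)%:R * e) = 60 * beta * n%:R * rho ^+ p.
    by rewrite /e /n natrM; ring.
  have -> : 14 * beta * kappa%:R * n%:R / K%:R = 14 * beta * n%:R * (2^-1) ^+ p.
    rewrite /K natrM exprVn -natrX -/kappa; field.
    by rewrite gt_eqF.
  have : 14 * beta * n%:R * (2^-1) ^+ p <= 14 * beta * n%:R * rho ^+ p.
    rewrite ler_wpM2l ?mulr_ge0// lerXn2r// nnegrE; lra.
  lra.
have [w1 w1z j1] := slope_jumpE heis_a m K l t x1 z K_gt0 xz1.
have [w2 w2z j2] := slope_jumpE heis_a m K l t x2 _ K_gt0 xz2.
have [w3 w3z j3] := slope_jumpE heis_b m K l t x3 z K_gt0 xz3.
have [w4 w4z j4] := slope_jumpE heis_b m K l t x4 _ K_gt0 xz4.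
rewrite j1 in J1; rewrite j2 in J2; rewrite j3 in J3; rewrite j4 in J4.
have Pa := parallel_increments heis_a heis_b heis_c
  heis_c_central heis_abc word_length_b kappa kappa_gt0
  (fun n r => word_length_central_sqr kappa n r kappa_gt0) n r w1 w2 rK.
have Pb := parallel_increments heis_b heis_a heis_c^-1%g
  heis_cV_central heis_bac word_length_a kappa kappa_gt0
  (fun n r => word_length_cV_sqr kappa n r kappa_gt0) n r w3 w4 rK.
rewrite w1z w2z in Pa; rewrite w3z w4z in Pb.
have Ta := slope_transfer _ _ _ _ _ _ _ _ KlR KR J1 J2 (Pa erefl).
have Tb := slope_transfer _ _ _ _ _ _ _ _ KlR KR J3 J4 (Pb erefl).
exists n, (z * heis_b ^+ n * heis_a ^+ n)%g; split.
- by rewrite /n leq_pmulr.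
- by rewrite leq_mul2l; apply/orP; right; rewrite leq_pexp2l// ltnW.
have -> : (z * heis_b ^+ n * heis_a ^+ n * heis_c ^+ (n * n)%N = z * heis_a ^+ n * heis_b ^+ n)%g.
  by rewrite -!mulgA (commutator_expg _ _ _ _ heis_c_central heis_abc) heis_c_comm !mulgA.
set P := f (_ * heis_b ^+ n)%g; set Q := f (_ * heis_a ^+ n)%g.
move: Ta Tb; rewrite -/n -/P -/Q.
set A := f (z * heis_a ^+ n)%g; set B := f (z * heis_b ^+ n)%g => Ta Tb.
have -> : P - Q = (P - A - (B - f z)) - (Q - B - (A - f z)).
  by rewrite !opprB addrACA !subrKA.
apply: (le_trans (is_norm_ler_sub _ _ _ normN _ _)); lra.
Qed.

End Collapse.

(** * The compression bound *)

(** The [2 ^ p] scales have ratio [4 ^ p], so the logarithm of the largest one is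
of order [p * 2 ^ p]. *)
Lemma ln_scale (R : realType) (d n p : nat) : (0 < d)%N -> (d <= 4 * n)%N ->
  (n <= 2 ^ p * (2 ^ p * 2 ^ p) ^ (2 ^ p))%N ->
  ln (d%:R : R) <= 5 * 4 ^+ p.
Proof.
move=> d_gt0 dn nle.
have d_le : (d <= 2 ^ (2 + p + (p + p) * 2 ^ p))%N.
  rewrite -expnD -expnM -expnD in nle.
  by rewrite -addnA expnD (leq_trans dn)// leq_mul2l.
have : ln (d%:R : R) <= ln (2 ^+ (2 + p + (p + p) * 2 ^ p)).
  by rewrite ler_ln ?posrE ?ltr0n// ?exprn_gt0// -natrX ler_nat.
rewrite lnXn// => /le_trans; apply.
have ln2 : ln (2 : R) <= 1 by have := @le_ln1Dx R 1; apply; lra.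
apply: (@le_trans _ _ (1 *+ (2 + p + (p + p) * 2 ^ p))); first exact: ler_wMn2r.
have -> : 5 * 4 ^+ p = (5 * (2 ^ p * 2 ^ p))%N%:R :> R.
  by rewrite -expnMn natrM natrX.
rewrite ler_nat; have := ltn_expl p (isT : (1 < 2)%N); nia.
Qed.

Theorem theorem1p1 (R : realType) (X : completeNormedModType R)
    (X_superreflexive : superreflexive X) :
  exists c C : R, [/\ 0 < c, 0 < C &
    forall f : heis -> X,
      (forall x y : heis, `|f x - f y| <= (d_W x y)%:R) ->
      forall n : nat, exists x y : heis,
        (n <= d_W x y)%N /\
        `|f x - f y| / (d_W x y)%:R <= C / (ln (d_W x y)%:R) `^ c].
Proof.
case: X_superreflexive => N [[normN [alpha [beta [alpha_gt0 beta_gt0 NX]]]] UC].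
have [k k01 convN] := uniformly_convex_sqr _ _ _ normN UC.
have [k_gt0 k_le1] := andP k01.
pose rho : R := Num.sqrt (1 + k)^-1.
have k1_gt0 : 0 < 1 + k by lra.
have rho_gt0 : 0 < rho by rewrite sqrtr_gt0 invr_gt0.
have rho2 : rho ^+ 2 * (1 + k) = 1.
  by rewrite sqr_sqrtr ?invr_ge0 ?(ltW k1_gt0)// mulVf// gt_eqF.
have rho_ge : 2^-1 <= rho.
  rewrite leNgt; apply/negP => small.
  have : rho ^+ 2 <= 2^-1 ^+ 2 by rewrite lerXn2r// ?nnegrE; lra.
  nra.
have rho_lt1 : rho < 1.
  rewrite ltNge; apply/negP => large.
  have : 1 ^+ 2 <= rho ^+ 2 by rewrite lerXn2r// ?nnegrE; lra.
  nra.
have ln4_gt0 : 0 < ln (4 : R) by rewrite ln_gt0//; lra.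
(* Chosen so that [(4 ^ p) ^ c = rho ^ (- p)]. *)
pose c := ln rho^-1 / ln 4.
have c_gt0 : 0 < c by rewrite divr_gt0// ln_gt0// invf_gt1.
have pow4c : 4 `^ c = rho^-1.
  by rewrite /powR gt_eqF// /c divfK ?gt_eqF// lnK// posrE invr_gt0.
pose C0 := 148 * beta / alpha.
have C0_gt0 : 0 < C0 by rewrite divr_gt0// mulr_gt0.
exists c, (C0 * 5 `^ c); split=> //; first by rewrite mulr_gt0// powR_gt0.
move=> f f_lip n0; pose p := n0.+1.
have f_lipN x g : N (f (x * g)%g - f x) <= beta * (word_length g)%:R.
  have /andP[_ NB] := NX (f (x * g)%g - f x); apply: (le_trans NB).
  by rewrite ler_wpM2l ?(ltW beta_gt0)// distrC -(d_W_mulr x) f_lip.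
have m_gt0 : (0 < 2 ^ p)%N by rewrite expn_gt0.
have [n [z [mn nm collapse]]] := center_collapse _ _ _ normN f beta (ltW beta_gt0) f_lipN
  k k01 convN _ p rho m_gt0 rho_ge rho2.
exists z, (z * heis_c ^+ (n * n)%N)%g; rewrite d_W_mulr.
set y := (z * _)%g in collapse *; set d := word_length _.
have nd : (n <= d)%N by exact: word_length_center_ge.
have dn : (d <= 4 * n)%N.
  by apply: leq_trans (word_length_central _ _) _; rewrite addnn -mul2n mulnA.
have pn : (2 <= n)%N by apply: leq_trans mn; rewrite /p expnS leq_pmulr// expn_gt0.
have d_gt1 : (1 < d)%N by exact: leq_trans nd.
split.
  apply: leq_trans nd; apply: leq_trans mn; apply: ltnW.
  by apply: leq_trans (ltn_expl n0 (isT : (1 < 2)%N)) _; rewrite leq_exp2l.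
have dR : 0 < d%:R :> R by rewrite ltr0n ltnW.
have lnd_gt0 : 0 < ln (d%:R : R) by rewrite ln_gt0// ltr1n.
have ratio : `|f z - f y| / d%:R <= C0 * rho ^+ p.
  rewrite ler_pdivrMr// distrC.
  have /andP[NA _] := NX (f y - f z).
  have : n%:R * (148 * beta * rho ^+ p) <= d%:R * (148 * beta * rho ^+ p).
    by rewrite ler_wpM2r ?ler_nat// !mulr_ge0 ?(ltW beta_gt0)// exprn_ge0// ltW.
  move=> nd_le; rewrite -(ler_pM2l alpha_gt0); apply: (le_trans NA).
  have -> : alpha * (C0 * rho ^+ p * d%:R) = d%:R * (148 * beta * rho ^+ p).
    by rewrite /C0; field; rewrite gt_eqF.
  by apply: le_trans nd_le; apply: (le_trans collapse); lra.
apply: (le_trans ratio); rewrite -mulrA ler_wpM2l ?(ltW C0_gt0)//.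
rewrite ler_pdivlMr ?powR_gt0//.
have : ln (d%:R : R) `^ c <= (5 * 4 ^+ p) `^ c.
  have pow_ge0 : 0 <= 5 * 4 ^+ p :> R by rewrite mulr_ge0// exprn_ge0.
  apply: ge0_ler_powR; rewrite ?nnegrE ?pow_ge0 ?(ltW c_gt0) ?(ltW lnd_gt0)//.
  exact: (ln_scale _ _ _ _ (ltnW d_gt1) dn nm).
have -> : (5 * 4 ^+ p) `^ c = 5 `^ c * rho^-1 ^+ p.
  rewrite powRM ?exprn_ge0//.
  congr (_ * _); rewrite -pow4c -(powR_mulrn p (ler0n R 4)) -(powR_mulrn p (powR_ge0 _ _)).
  by rewrite -!powRrM mulrC.
move=> le_pow; apply: (@le_trans _ _ (rho ^+ p * (5 `^ c * rho^-1 ^+ p))).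
  by rewrite ler_wpM2l// exprn_ge0// ltW.
by rewrite mulrCA -exprMn divff ?gt_eqF// expr1n mulr1.
Qed.
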